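(* Let $m\ge 2$, $n\ge 1$ and $\mathcal{A}\in T_{m,n}$. Then: (i) if $\mathcal{A}$ is semi-positive (resp. strictly semi-positive), then all $H^+$-eigenvalues of each principal sub-tensor of $\mathcal{A}$ are nonnegative (resp. positive); (ii) if $\mathcal{A}$ is semi-positive (resp. strictly semi-positive), then all $Z^+$-eigenvalues of each principal sub-tensor of $\mathcal{A}$ are nonnegative (resp. positive).
   Context: $T_{m,n}$ is the set of real tensors $\mathcal{A}=(a_{i_1\cdots i_m})$ of order $m$ and dimension $n$, with indices in $I_n=\{1,\dots,n\}$ and no symmetry assumed. For $x\in\mathbb{R}^n$, $\mathcal{A}x^{m-1}\in\mathbb{R}^n$ has components $(\mathcal{A}x^{m-1})_i=\sum_{i_2,\dots,i_m=1}^n a_{ii_2\cdots i_m}x_{i_2}\cdots x_{i_m}$, and $x^{[m-1]}=(x_1^{m-1},\dots,x_n^{m-1})^\top$. Inequalities between vectors are componentwise. $\mathcal{A}$ is semi-positive (resp. strictly semi-positive) if for each $x\ge 0$, $x\ne 0$, there is $k\in I_n$ with $x_k>0$ and $(\mathcal{A}x^{m-1})_k\ge 0$ (resp. $(\mathcal{A}x^{m-1})_k>0$). For nonempty $J\subset I_n$ with $|J|=r$, the principal sub-tensor $\mathcal{A}^J_r\in T_{m,r}$ is the tensor with entries $a_{i_1\cdots i_m}$, $i_1,\dots,i_m\in J$. A real number $\lambda$ is an $H^+$-eigenvalue of $\mathcal{A}$ if there is a nonzero $x\in\mathbb{R}^n$, $x\ge 0$, with $\mathcal{A}x^{m-1}=\lambda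 x^{[m-1]}$; it is a $Z^+$-eigenvalue of $\mathcal{A}$ if there is $x\in\mathbb{R}^n$, $x\ge 0$, with $x^\top x=1$ and $\mathcal{A}x^{m-1}=\lambda x$. *)

(* Defs.v *)
From HB Require Import structures.
From mathcomp Require Import all_boot all_order all_algebra.
From mathcomp Require Import reals.
Set Implicit Arguments.
Unset Strict Implicit.
Unset Printing Implicit Defensive.
Import Order.TTheory GRing.Theory Num.Theory.
Local Open Scope ring_scope.

(* Indices run over {0, ..., n-1} instead of {1, ..., n}. *)
Definition tensor (R : realType) (m n : nat) := {ffun m.-tuple 'I_n -> R}.

Definition nonneg_vec (R : realType) (n : nat) (x : 'cV[R]_n) : Prop :=
  forall i, 0 <= x i 0.

(* The vector A x^{m-1}: component i sums over the index tuples
   (i_1, ..., i_m) with i_1 = i, and the product runs over i_2, ..., i_m.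
   Stating i_1 = i with ohead makes sense for every m; the intended range is
   m >= 1. *)
Definition tensor_apply (R : realType) (m n : nat) (A : tensor R m n)
    (x : 'cV[R]_n) : 'cV[R]_n :=
  \col_(i < n) \sum_(t : m.-tuple 'I_n | ohead t == Some i)
    A t * \prod_(j <- behead t) x j 0.

Definition vec_pow (R : realType) (n : nat) (x : 'cV[R]_n) (k : nat) :
    'cV[R]_n :=
  \col_(i < n) x i 0 ^+ k.

Definition semi_positive (R : realType) (m n : nat) (A : tensor R m n) : Prop :=
  forall x : 'cV[R]_n, nonneg_vec x -> x != 0 ->
    exists k : 'I_n, 0 < x k 0 /\ 0 <= tensor_apply A x k 0.

Definition strictly_semi_positive (R : realType) (m n : nat)
    (A : tensor R m n) : Prop :=
  forall x : 'cV[R]_n, nonneg_vec x -> x != 0 ->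
    exists k : 'I_n, 0 < x k 0 /\ 0 < tensor_apply A x k 0.

(* The elements of J are renumbered 0, ..., #|J|-1 in increasing order. *)
Definition principal_subtensor (R : realType) (m n : nat) (A : tensor R m n)
    (J : {set 'I_n}) : tensor R m #|J| :=
  [ffun t : m.-tuple 'I_#|J| => A (map_tuple (@enum_val _ (mem J)) t)].

Definition Hplus_eigenvalue (R : realType) (m n : nat) (A : tensor R m n)
    (lambda : R) : Prop :=
  exists x : 'cV[R]_n,
    [/\ x != 0, nonneg_vec x & tensor_apply A x = lambda *: vec_pow x m.-1].

Definition Zplus_eigenvalue (R : realType) (m n : nat) (A : tensor R m n)
    (lambda : R) : Prop :=
  exists x : 'cV[R]_n,
    [/\ nonneg_vec x, x^T *m x = 1%:M & tensor_apply A x = lambda *: x].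

(* Main.v *)
(* (Strict) semi-positivity passes to principal sub-tensors: extend a vector
   indexed by J by zero, so that every term of A x^{m-1} with an index outside J
   vanishes, and the index k supplied by semi-positivity lies in J because
   x_k > 0.  Reading the eigenvalue equation of a (strictly) semi-positive
   tensor at such a k gives the sign of lambda, since x_k and x_k^{m-1} are
   positive. *)
Require Import Defs.
From HB Require Import structures.
From mathcomp Require Import all_boot all_order all_algebra.
From mathcomp Require Import reals.
Set Implicit Arguments.
Unset Strict Implicit.
Unset Printing Implicit Defensive.
Import Order.TTheory GRing.Theory Num.Theory.
Local Open Scope ring_scope.

Section ZeroExtension.

Variables (R : realType) (n : nat) (J : {set 'I_n}).

(** Since [enum_val] is injective, the sum has exactly one term when [k] lies in [J] and is empty
    otherwise. Writing it as a sum avoids a rank function, which would need a proof that [k] is in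
    [J]. *)
Definition zero_extension (x : 'cV[R]_#|J|) : 'cV[R]_n :=
  \col_k \sum_(i < #|J| | enum_val i == k) x i 0.

Lemma zero_extension_val (x : 'cV[R]_#|J|) i :
  zero_extension x (enum_val i) 0 = x i 0.
Proof.
by rewrite mxE (eq_bigl (pred1 i)) ?big_pred1_eq // => j; rewrite (inj_eq enum_val_inj).
Qed.

Lemma zero_extension_notin (x : 'cV[R]_#|J|) k :
  k \notin J -> zero_extension x k 0 = 0.
Proof.
move=> kJ; rewrite mxE big_pred0 // => i; apply/negbTE.
by apply: contraNneq kJ => <-; apply: enum_valP.
Qed.

Lemma zero_extension_nonneg (x : 'cV[R]_#|J|) :
  nonneg_vec x -> nonneg_vec (zero_extension x).
Proof. by move=> x0 k; rewrite mxE sumr_ge0. Qed.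

Lemma zero_extension_neq0 (x : 'cV[R]_#|J|) : x != 0 -> zero_extension x != 0.
Proof.
apply: contraNneq => y0; apply/eqP/colP => i.
by rewrite -zero_extension_val y0 !mxE.
Qed.

(** The index tuples that survive have all entries in [J]; entrywise [enum_val] matches them
    bijectively with the index tuples of the sub-tensor. *)
Lemma tensor_apply_zero_extension m (A : tensor R m n) (x : 'cV[R]_#|J|) i :
  tensor_apply A (zero_extension x) (enum_val i) 0 =
  tensor_apply (principal_subtensor A J) x i 0.
Proof.
rewrite !mxE (bigID (fun t : m.-tuple 'I_n => all (mem J) t)) /=.
(* In a tuple that leaves [J], the head [enum_val i] is in [J], so the offending index sits in the
   tail and contributes a zero factor to the product. *)
rewrite [X in _ + X]big1 ?addr0; last first.
  move=> t /andP[/eqP hd]; case: (tval t) hd => //= a s [->].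
  rewrite enum_valP /= => /allPn[j js jJ].
  by rewrite (big_rem j) //= zero_extension_notin // mul0r mulr0.
(* [enum_rank_in] needs a witness that [J] is inhabited, here [enum_val i]. It inverts [enum_val]
   only on [J], which is why the tuples leaving [J] were removed first. *)
rewrite (reindex_onto (map_tuple (@enum_val _ (mem J)))
  (map_tuple (enum_rank_in (enum_valP i)))) /=; last first.
  move=> t /andP[_ /allP tJ]; apply: val_inj => /=.
  by rewrite -map_comp map_id_in // => j /tJ jJ /=; rewrite enum_rankK_in.
apply: eq_big => [t|t _].
  have -> : all (mem J) (map enum_val t).
    by rewrite all_map; apply/allP => j _ /=; apply: enum_valP.
  have -> : map_tuple (enum_rank_in (enum_valP i))
              (map_tuple (@enum_val _ (mem J)) t) == t.
    apply/eqP/val_inj => /=; rewrite -map_comp map_id_in // => j _ /=.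
    exact: enum_valK_in.
  (* On an empty tuple both head conditions are false; otherwise injectivity of [enum_val]
     identifies them. *)
  rewrite !andbT; case: (tval t) => //= a s.
  by rewrite !(inj_eq Some_inj) (inj_eq enum_val_inj).
rewrite ffunE behead_map big_map; congr (_ * _).
by apply: eq_bigr => j _; rewrite zero_extension_val.
Qed.

Lemma zero_extension_gt0 (x : 'cV[R]_#|J|) k :
  0 < zero_extension x k 0 -> exists2 i, k = enum_val i & 0 < x i 0.
Proof.
move=> yk; have kJ : k \in J.
  by apply: contraTT yk => /zero_extension_notin->; rewrite ltxx.
exists (enum_rank_in kJ k); first by rewrite enum_rankK_in.
by rewrite -zero_extension_val enum_rankK_in.
Qed.

Lemma semi_positive_principal_subtensor m (A : tensor R m n) :
  semi_positive A -> semi_positive (principal_subtensor A J).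
Proof.
move=> Apos x x_ge0 x_neq0.
have [k [/zero_extension_gt0[i -> xi_gt0]]] :=
  Apos _ (zero_extension_nonneg x_ge0) (zero_extension_neq0 x_neq0).
by rewrite tensor_apply_zero_extension; exists i.
Qed.

Lemma strictly_semi_positive_principal_subtensor m (A : tensor R m n) :
  strictly_semi_positive A -> strictly_semi_positive (principal_subtensor A J).
Proof.
move=> Apos x x_ge0 x_neq0.
have [k [/zero_extension_gt0[i -> xi_gt0]]] :=
  Apos _ (zero_extension_nonneg x_ge0) (zero_extension_neq0 x_neq0).
by rewrite tensor_apply_zero_extension; exists i.
Qed.

End ZeroExtension.

Section Eigenvalues.

Variables (R : realType) (m n : nat) (A : tensor R m n) (lambda : R).

(** Semi-positivity is tested on nonzero vectors only; for $Z^+$-eigenvectors the normalisation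
    provides this, as [x = 0] would give 0 = 1 in the single entry of the product. *)
Lemma unit_vec_neq0 (x : 'cV[R]_n) : x^T *m x = 1%:M -> x != 0.
Proof.
move=> x1; apply/eqP => x0; move: x1; rewrite x0 mulmx0 => /matrixP/(_ 0 0)/eqP.
by rewrite !mxE eqxx eq_sym oner_eq0.
Qed.

(** This and the next three bounds concern an arbitrary tensor, so that they apply to a principal
    sub-tensor in its own dimension [#|J|]. *)
Lemma semi_positive_Hplus_ge0 :
  semi_positive A -> Hplus_eigenvalue A lambda -> 0 <= lambda.
Proof.
move=> Apos [x [x_neq0 x_ge0 Ax]]; have [k [xk_gt0]] := Apos _ x_ge0 x_neq0.
by rewrite Ax !mxE pmulr_lge0 // exprn_gt0.
Qed.

Lemma strictly_semi_positive_Hplus_gt0 :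
  strictly_semi_positive A -> Hplus_eigenvalue A lambda -> 0 < lambda.
Proof.
move=> Apos [x [x_neq0 x_ge0 Ax]]; have [k [xk_gt0]] := Apos _ x_ge0 x_neq0.
by rewrite Ax !mxE pmulr_lgt0 // exprn_gt0.
Qed.

Lemma semi_positive_Zplus_ge0 :
  semi_positive A -> Zplus_eigenvalue A lambda -> 0 <= lambda.
Proof.
move=> Apos [x [x_ge0 /unit_vec_neq0 x_neq0 Ax]].
by have [k [xk_gt0]] := Apos _ x_ge0 x_neq0; rewrite Ax mxE pmulr_lge0.
Qed.

Lemma strictly_semi_positive_Zplus_gt0 :
  strictly_semi_positive A -> Zplus_eigenvalue A lambda -> 0 < lambda.
Proof.
move=> Apos [x [x_ge0 /unit_vec_neq0 x_neq0 Ax]].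
by have [k [xk_gt0]] := Apos _ x_ge0 x_neq0; rewrite Ax mxE pmulr_lgt0.
Qed.

End Eigenvalues.

Theorem corollary3p6 (R : realType) (m n : nat) (hm : (2 <= m)%N)
    (hn : (1 <= n)%N) (A : tensor R m n) :
  ((semi_positive A ->
      forall J : {set 'I_n}, J != set0 -> forall lambda : R,
        Hplus_eigenvalue (principal_subtensor A J) lambda -> 0 <= lambda) /\
   (strictly_semi_positive A ->
      forall J : {set 'I_n}, J != set0 -> forall lambda : R,
        Hplus_eigenvalue (principal_subtensor A J) lambda -> 0 < lambda)) /\
  ((semi_positive A ->
      forall J : {set 'I_n}, J != set0 -> forall lambda : R,
        Zplus_eigenvalue (principal_subtensor A J) lambda -> 0 <= lambda) /\
   (strictly_semi_positive A ->
      forall J : {set 'I_n}, J != set0 -> forall lambda : R,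
        Zplus_eigenvalue (principal_subtensor A J) lambda -> 0 < lambda)).
Proof.
split; split=> Apos J _ lambda.
- exact/semi_positive_Hplus_ge0/semi_positive_principal_subtensor.
- exact/strictly_semi_positive_Hplus_gt0/strictly_semi_positive_principal_subtensor.
- exact/semi_positive_Zplus_ge0/semi_positive_principal_subtensor.
- exact/strictly_semi_positive_Zplus_gt0/strictly_semi_positive_principal_subtensor.
Qed.
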